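(* Let $n\ge 1$ and let $f(s)=s^{n}+a_{n-1}s^{n-1}+\ldots+a_{1}s+a_{0}$ and $g(s)=s^{n}+b_{n-1}s^{n-1}+\ldots+b_{1}s+b_{0}$ be monic polynomials of degree $n$ with complex coefficients. Let $N_f=\{k\in\{0,\ldots,n-1\}:a_k\ne 0\}$ and $N_g=\{k\in\{0,\ldots,n-1\}:b_k\neq 0\}$. (a) If $f$ satisfies the stability condition and $|b_k|\le 1$ for every $k\in N_g\cap N_f$, then both the Szegő product and the Hadamard product of $f$ and $g$ satisfy the stability condition (and thus are Schur stable). (b) If $f$ satisfies the stability condition and $|b_k|\le\binom{n}{k}$ for every $k\in N_g\cap N_f$, then the Szegő product of $f$ and $g$ satisfies the stability condition (and thus is Schur stable). In particular, if $f$ satisfies the stability condition and $g$ is Schur stable, then the Szegő product of $f$ and $g$ satisfies the stability condition (and thus is Schur stable). (c) If $f$ and $g$ satisfy $$\max\{|a_k|,|b_k|\}<\sqrt{\lambda_k}\quad\text{for every } k\in N_f\cap N_g,$$ where $\{\lambda_k\}$ is a sequence of positive numbers whose sum does not exceed $1$, then both the Szegő product and the Hadamard product of $f$ and $g$ satisfy the stability condition (and thus are Schur stable).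
   Context: A polynomial is Schur stable if all its zeros lie in the open unit disc $\{z\in\mathbb{C}:|z|<1\}$. Stability condition: a monic complex polynomial $q(s)=s^n+c_{n-1}s^{n-1}+\ldots+c_0$ satisfies the stability condition if there exists a sequence $\{\lambda_k\}$ of positive numbers whose sum does not exceed $1$ such that $|c_k|<\lambda_k$ for every $k\in N_q=\{k\in\{0,\ldots,n-1\}:c_k\neq 0\}$ (the condition holds vacuously when $N_q$ is empty). Sequences $\{\lambda_k\}$ here are finite and indexed by the relevant set of indices: $N_q$ in the stability condition and $N_f\cap N_g$ in part (c). The Hadamard product of $f$ and $g$ is $(f\circ g)(s)=s^n+a_{n-1}b_{n-1}s^{n-1}+\ldots+a_1b_1s+a_0b_0$. The Szegő product of $f$ and $g$ is $f\circ g\circ h$ with $h(s)=\sum_{k=0}^{n}\binom{n}{k}^{-1}s^k$, i.e. the polynomial $s^n+\sum_{k=0}^{n-1}\binom{n}{k}^{-1}a_kb_k s^k$. *)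

(* Defs.v *)
From mathcomp Require Import all_boot all_order all_algebra.
From mathcomp Require Import complex.
From mathcomp Require Import reals.

Set Implicit Arguments.
Unset Strict Implicit.
Unset Printing Implicit Defensive.

Import Order.TTheory GRing.Theory Num.Theory.
Local Open Scope ring_scope.
Local Open Scope complex_scope.

Section Defs.
Variable R : realType.
Implicit Types (p q f g : {poly R[i]}) (n : nat).

Definition schur_stable q : Prop := forall z : R[i], root q z -> `|z| < 1.

(* The indices k < deg q with a nonzero coefficient; the leading index is
   excluded. *)
Definition nzidx q : {pred nat} :=
  [pred k | (k < (size q).-1)%N && (q`_k != 0)].

(* The norm on R[i] is R[i]-valued, so real bounds are embedded by %:C. Only the
   values of lam on nzidx q are constrained, so lam stands for a finite
   sequence indexed by nzidx q. *)
Definition stability_condition q : Prop :=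
  q \is monic /\
  exists lam : nat -> R,
    [/\ forall k, k \in nzidx q -> 0 < lam k,
        \sum_(k < (size q).-1 | (k : nat) \in nzidx q) lam k <= 1
      & forall k, k \in nzidx q -> `|q`_k| < (lam k)%:C].

Definition hadamard p q : {poly R[i]} := \poly_(k < size p) (p`_k * q`_k).

Definition szego n f g : {poly R[i]} :=
  hadamard (hadamard f g) (\poly_(k < n.+1) ('C(n, k)%:R)^-1).

Lemma hadamardE n f g : f \is monic -> g \is monic ->
    size f = n.+1 -> size g = n.+1 ->
  hadamard f g = 'X^n + \sum_(k < n) (f`_k * g`_k) *: 'X^k.
Proof.
move=> /monicP; rewrite lead_coefE => mf /monicP; rewrite lead_coefE => mg.
move=> sf sg; move: mf mg; rewrite /hadamard sf sg /= => fn gn.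
by rewrite poly_def big_ord_recr /= fn gn mulr1 scale1r addrC.
Qed.

Lemma szegoE n f g : f \is monic -> g \is monic ->
    size f = n.+1 -> size g = n.+1 ->
  szego n f g = 'X^n + \sum_(k < n) (('C(n, k)%:R)^-1 * f`_k * g`_k) *: 'X^k.
Proof.
move=> mf mg sf sg; have := hadamardE mf mg sf sg.
move: mf mg => /monicP; rewrite lead_coefE => fn /monicP; rewrite lead_coefE.
move: fn; rewrite sf sg /= => fn gn _.
have sh : size (hadamard f g) = n.+1.
  by rewrite /hadamard sf size_poly_eq //= fn gn mulr1 oner_neq0.
rewrite /szego {1}/hadamard sh poly_def big_ord_recr /= addrC !coef_poly.
rewrite sf ltnSn fn gn binn invr1 !mulr1 scale1r; congr (_ + _).
apply: eq_bigr => k _; rewrite !coef_poly sf ltnS (ltnW (ltn_ord k)).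
by rewrite mulrC mulrA.
Qed.

End Defs.

(* Main.v *)
Require Import Defs.
From mathcomp Require Import all_boot all_order all_algebra.
From mathcomp Require Import complex.
From mathcomp Require Import reals.

Import Order.TTheory GRing.Theory Num.Theory.
Local Open Scope ring_scope.
Local Open Scope complex_scope.

(** Because an inequality that is strict at each of finitely many indices leaves
    room to spare, the weights in the stability condition can be eliminated: a
    monic polynomial satisfies the condition exactly when the moduli of its
    coefficients below the leading one add up to less than 1
    ([stability_conditionP]). If the sum S of the moduli is less than 1, adding
    (1 - S) / n to each modulus gives admissible weights.

    In this form Schur stability is Cauchy's estimate: at a zero z with
    1 <= |z| the leading term z ^ n would equal minus a sum of modulus at most
    S |z| ^ n < |z| ^ n ([stability_condition_schur]). Moreover the condition
    is inherited by every Hadamard product with coefficients of modulus at most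
    1 ([stability_condition_hadamard]). The Szegő product of f and g is the
    Hadamard product of f with the polynomial of coefficients b_k / C(n, k)
    ([szego_hadamard]), which turns (b) into an instance of that inheritance;
    the Szegő half of (a) follows from (b) since 1 <= C(n, k).

    A Schur stable monic g has |b_k| <= C(n, k), because b_k is, up to sign, a
    sum of C(n, k) products of zeros of g ([coef_prod_XsubC_le]). In (c) the
    hypothesis gives |a_k b_k| < lam_k wherever the product is nonzero, so the
    Hadamard product satisfies the condition directly, and dividing further by
    C(n, k) preserves it. *)

Section StabilityCondition.
Variable R : realType.
Implicit Types (p q f g h : {poly R[i]}) (n : nat).

Lemma notin_nzidx q k : (k < (size q).-1)%N -> k \notin nzidx q -> q`_k = 0.
Proof. by move=> kq; rewrite inE kq /= negbK => /eqP. Qed.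

(** Strictness has two sources: a term indexed by [P] if there is one, and
    0 < 1 otherwise. *)
Lemma sum_lt1 n (P : pred 'I_n) (x : 'I_n -> R[i]) (lam : 'I_n -> R) :
    (forall k, P k -> x k < (lam k)%:C) -> (forall k, ~~ P k -> x k = 0) ->
  \sum_(k | P k) lam k <= 1 -> \sum_k x k < 1.
Proof.
move=> xlam x0 lam1.
rewrite (bigID P) /= [X in _ + X]big1 // addr0.
have [k Pk|P0] := pickP P; last by rewrite big_pred0 // ltr01.
apply: (@lt_le_trans _ _ (\sum_(k | P k) (lam k)%:C)).
  rewrite (bigD1 k) //= [ltRHS](bigD1 k) //=.
  apply: ltr_leD; first exact: xlam.
  by apply: ler_sum => j /andP[Pj _]; exact/ltW/xlam.
by rewrite -rmorph_sum /= -[1]/(1%:C) lecR.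
Qed.

(** This makes the condition depend on the moduli of the coefficients alone, so
    that products are compared term by term without transporting weights. *)
Lemma stability_conditionP q :
  stability_condition q <->
  q \is monic /\ \sum_(k < (size q).-1) `|q`_k| < 1.
Proof.
split=> [[mq [lam [_ lam1 qlam]]]|[mq q1]]; split=> //.
  apply: (sum_lt1 _ _ _ _ _ _ lam1) => k; first exact: qlam.
  by move/(notin_nzidx _ _ (ltn_ord k)) ->; rewrite normr0.
set n := (size q).-1 in q1 *.
pose r k := complex.Re `|q`_k|.
have rE k : `|q`_k| = (r k)%:C by rewrite /r RRe_real // normr_real.
have r_ge0 k : 0 <= r k by rewrite -lecR -rE normr_ge0.
pose S := \sum_(k < n) r k.
have S1 : S < 1.
  by move: q1; under eq_bigr do rewrite rE; rewrite -rmorph_sum /= -[1]/(1%:C) ltcR.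
(* The spare room 1 - S is shared equally among the n indices; if n = 0 then e
   is 0 and no index requires it to be positive. *)
pose e := (1 - S) / n%:R.
have e_ge0 : 0 <= e by rewrite divr_ge0 ?ler0n // subr_ge0 ltW.
have e_gt0 k : (k < n)%N -> 0 < e.
  by move=> kn; rewrite divr_gt0 ?subr_gt0 // ltr0n (leq_ltn_trans _ kn).
exists (fun k => r k + e); split=> [k /andP[kn _]||k /andP[kn _]].
- exact: ltr_wpDl (r_ge0 k) (e_gt0 _ kn).
- apply: (@le_trans _ _ (\sum_(k < n) (r k + e))).
    rewrite [leRHS](bigID (fun k : 'I_n => (k : nat) \in nzidx q)) /=.
    by rewrite lerDl sumr_ge0 // => k _; rewrite addr_ge0.
  rewrite big_split /= sumr_const card_ord -/S.
  have [n0|n_gt0] := posnP n; first by rewrite n0 mulr0n addr0 ltW.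
  by rewrite -mulr_natr divfK ?pnatr_eq0 -?lt0n // addrC subrK.
- by rewrite rE ltcR ltrDl (e_gt0 _ kn).
Qed.

(** For 1 <= |z| every power |z| ^ k with k < n is at most |z| ^ n, so the lower
    terms together are too small to cancel z ^ n. *)
Lemma stability_condition_schur q : stability_condition q -> schur_stable q.
Proof.
move=> /stability_conditionP[mq q1] z /rootP qz.
rewrite real_ltNge ?normr_real ?real1 //; apply/negP => z1.
have sq : size q = (size q).-1.+1 by rewrite prednK // size_poly_gt0 monic_neq0.
move: qz; rewrite horner_coef sq big_ord_recr /=.
move/monicP: (mq); rewrite lead_coefE => ->; rewrite mul1r.
set n := (size q).-1 in q1 *.
have zn0 : 0 < `|z| ^+ n by rewrite exprn_gt0 // (lt_le_trans ltr01).
move/eqP; rewrite addrC addr_eq0 => /eqP /(congr1 Num.norm).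
rewrite normrN normrX => znE.
suff: `|z| ^+ n < `|z| ^+ n by rewrite ltxx.
rewrite {1}znE (le_lt_trans (ler_norm_sum _ _ _)) //.
apply: (@le_lt_trans _ _ ((\sum_(k < n) `|q`_k|) * `|z| ^+ n)); last first.
  by rewrite -[ltRHS]mul1r ltr_pM2r.
rewrite mulr_suml ler_sum // => k _; rewrite normrM normrX.
by rewrite ler_wpM2l // ler_weXn2l // ltnW.
Qed.

Lemma size_hadamard_monic p q : p \is monic -> q`_(size p).-1 = 1 ->
  hadamard p q \is monic /\ size (hadamard p q) = size p.
Proof.
move=> mp q1; have p_gt0 : (0 < size p)%N by rewrite size_poly_gt0 monic_neq0.
have p1 : p`_(size p).-1 = 1 by rewrite -lead_coefE; exact/monicP.
have sE : size (hadamard p q) = size p.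
  by rewrite /hadamard size_poly_eq // p1 q1 mulr1 oner_neq0.
split=> //; apply/monicP.
by rewrite lead_coefE sE coef_poly ltn_predL p_gt0 p1 q1 mulr1.
Qed.

Lemma coef_hadamard p q k : (hadamard p q)`_k = p`_k * q`_k.
Proof.
by rewrite coef_poly; case: ltnP => // kp; rewrite nth_default ?mul0r.
Qed.

Lemma stability_condition_hadamard f g :
    stability_condition f -> g`_(size f).-1 = 1 ->
    (forall k, k \in nzidx f -> `|g`_k| <= 1) ->
  stability_condition (hadamard f g).
Proof.
move=> /stability_conditionP[mf f1] gn g1; apply/stability_conditionP.
have [mfg ->] := size_hadamard_monic _ _ mf gn; split=> //.
apply: le_lt_trans f1; apply: ler_sum => k _.
rewrite coef_hadamard normrM.
have [kf|/(notin_nzidx _ _ (ltn_ord k)) ->] := boolP ((k : nat) \in nzidx f).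
  by rewrite ler_piMr // g1.
by rewrite normr0 mul0r.
Qed.

(** The third factor of the Szegő product. *)
Definition invbin_poly n : {poly R[i]} := \poly_(k < n.+1) ('C(n, k)%:R)^-1.

Lemma coef_invbin_poly n k : (k <= n)%N ->
  (invbin_poly n)`_k = ('C(n, k)%:R)^-1.
Proof. by move=> kn; rewrite coef_poly ltnS kn. Qed.

Lemma norm_coef_invbin_poly n k : (k <= n)%N -> `|(invbin_poly n)`_k| <= 1.
Proof.
move=> kn; rewrite coef_invbin_poly // normfV normr_nat.
by rewrite invf_le1 ?ltr0n ?bin_gt0 // ler1n bin_gt0.
Qed.

(** Grouping the inverse binomials with g lets a bound |b_k| <= C(n, k) act as
    a bound by 1. *)
Lemma szego_hadamard n f g : szego n f g = hadamard f (hadamard g (invbin_poly n)).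
Proof. by apply/polyP => k; rewrite /szego !coef_hadamard mulrA. Qed.

Lemma stability_condition_szego n f g :
    stability_condition f -> size f = n.+1 -> g`_n = 1 ->
    (forall k, k \in nzidx f -> `|g`_k| <= 'C(n, k)%:R) ->
  stability_condition (szego n f g).
Proof.
move=> sf szf gn gbin; rewrite szego_hadamard.
apply: stability_condition_hadamard => //.
  by rewrite szf coef_hadamard gn coef_invbin_poly // binn invr1 mulr1.
move=> k kf; move: (kf); rewrite inE szf /= => /andP[kn _].
rewrite coef_hadamard coef_invbin_poly 1?ltnW // normrM normfV normr_nat.
by rewrite ler_pdivrMr ?ltr0n ?bin_gt0 1?ltnW // mul1r gbin.
Qed.

(** Multiplication by a further factor ['X - z] replaces the coefficients b_k by
    b_(k-1) - z b_k, so the bound propagates by Pascal's rule. *)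
Lemma coef_prod_XsubC_le (s : seq R[i]) k : (forall z, z \in s -> `|z| <= 1) ->
  `|(\prod_(z <- s) ('X - z%:P))`_k| <= 'C(size s, k)%:R.
Proof.
elim: s k => [|z s IHs] k s1.
  by rewrite big_nil coef1 normr_nat; case: k.
have {}IHs j : `|(\prod_(w <- s) ('X - w%:P))`_j| <= 'C(size s, j)%:R.
  by apply: IHs => w ws; rewrite s1 // in_cons ws orbT.
rewrite big_cons mulrBl coefB coefXM coefCM /=.
have zb j : `|z * (\prod_(w <- s) ('X - w%:P))`_j| <= 'C(size s, j)%:R.
  by rewrite normrM -[leRHS]mul1r ler_pM // s1 // mem_head.
case: k => [|k] /=; first by rewrite sub0r normrN (le_trans (zb 0)) // !bin0.
rewrite binS addnC natrD (le_trans (ler_normB _ _)) //.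
exact: lerD (IHs k) (zb k.+1).
Qed.

Lemma schur_stable_coef_le g k : g \is monic -> schur_stable g ->
  `|g`_k| <= 'C((size g).-1, k)%:R.
Proof.
move=> mg sg; have [s] := closed_field_poly_normal g.
rewrite (monicP mg) scale1r => gE.
have -> : (size g).-1 = size s by rewrite gE size_prod_XsubC.
rewrite {1}gE; apply: coef_prod_XsubC_le => z zs.
by apply/ltW/sg; rewrite gE root_prod_XsubC.
Qed.

(** The two factors of each product are below sqrt lam_k, so the weights lam_k
    bound the products themselves; where one factor vanishes there is nothing
    to bound. *)
Lemma stability_condition_hadamard_sqrt n f g (lam : nat -> R) :
    f \is monic -> size f = n.+1 -> g \is monic -> size g = n.+1 ->
    (forall k, k \in nzidx f -> k \in nzidx g -> 0 < lam k) ->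
    \sum_(k < n | ((k : nat) \in nzidx f) && ((k : nat) \in nzidx g)) lam k
      <= 1 ->
    (forall k, k \in nzidx f -> k \in nzidx g ->
       Num.max `|f`_k| `|g`_k| < (Num.sqrt (lam k))%:C) ->
  stability_condition (hadamard f g).
Proof.
move=> mf szf mg szg lam0 lam1 fglam; apply/stability_conditionP.
have gn : g`_(size f).-1 = 1 by rewrite szf -szg -lead_coefE; exact/monicP.
have [mfg ->] := size_hadamard_monic _ _ mf gn; split=> //; rewrite szf /=.
apply: (sum_lt1 _ _ _ _ _ _ lam1) => k; rewrite coef_hadamard normrM.
  case/andP => kf kg; move: (fglam _ kf kg).
  rewrite comparable_gt_max ?real_comparable ?normr_real // => /andP[fk gk].
  rewrite -[X in X%:C](sqr_sqrtr (ltW (lam0 _ kf kg))) expr2 rmorphM /=.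
  exact: ltr_pM.
rewrite negb_and => /orP[kf|kg].
  by rewrite (notin_nzidx f) ?szf ?ltn_ord // normr0 mul0r.
by rewrite (notin_nzidx g) ?szg ?ltn_ord // normr0 mulr0.
Qed.

End StabilityCondition.

Theorem theorem3 (R : realType) (n : nat) (hn : (0 < n)%N)
    (f g : {poly R[i]})
    (f_monic : f \is monic) (f_size : size f = n.+1)
    (g_monic : g \is monic) (g_size : size g = n.+1) :
  [/\ (* (a) *)
      stability_condition f ->
      (forall k : nat, k \in nzidx g -> k \in nzidx f -> `|g`_k| <= 1) ->
      (stability_condition (szego n f g) /\ schur_stable (szego n f g)) /\
      (stability_condition (hadamard f g) /\ schur_stable (hadamard f g)),
      (* (b) *)
      stability_condition f ->
      (forall k : nat, k \in nzidx g -> k \in nzidx f ->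
         `|g`_k| <= 'C(n, k)%:R) ->
      stability_condition (szego n f g) /\ schur_stable (szego n f g),
      (* (b), in particular *)
      stability_condition f -> schur_stable g ->
      stability_condition (szego n f g) /\ schur_stable (szego n f g)
    & (* (c) *)
      forall lam : nat -> R,
      (forall k : nat, k \in nzidx f -> k \in nzidx g -> 0 < lam k) ->
      \sum_(k < n | ((k : nat) \in nzidx f) && ((k : nat) \in nzidx g)) lam k
        <= 1 ->
      (forall k : nat, k \in nzidx f -> k \in nzidx g ->
         Num.max `|f`_k| `|g`_k| < (Num.sqrt (lam k))%:C) ->
      (stability_condition (szego n f g) /\ schur_stable (szego n f g)) /\
      (stability_condition (hadamard f g) /\ schur_stable (hadamard f g))].
Proof.
have gn : g`_n = 1 by rewrite -[n]/(n.+1.-1) -g_size -lead_coefE; exact/monicP.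
have gE k : k \in nzidx f -> k \notin nzidx g -> g`_k = 0.
  by rewrite inE f_size => /andP[kn _]; apply: notin_nzidx; rewrite g_size.
have schur q : stability_condition q -> stability_condition q /\ schur_stable q.
  by split=> //; exact: stability_condition_schur.
have b : stability_condition f ->
    (forall k, k \in nzidx g -> k \in nzidx f -> `|g`_k| <= 'C(n, k)%:R) ->
    stability_condition (szego n f g).
  move=> sf gbin; apply: stability_condition_szego => // k kf.
  have [kg|kg] := boolP (k \in nzidx g); first exact: gbin.
  by rewrite gE // normr0 ler0n.
split=> [sf g1|sf gbin|sf sg|lam lam0 lam1 fglam].
- split; apply: (schur).
    apply: b => // k kg kf; apply: (le_trans (g1 _ kg kf)).
    move: kf; rewrite inE f_size => /andP[kn _].
    by rewrite ler1n bin_gt0 ltnW.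
  apply: stability_condition_hadamard => //; first by rewrite f_size.
  move=> k kf; have [kg|kg] := boolP (k \in nzidx g); first exact: g1.
  by rewrite gE // normr0 ler01.
- exact/schur/b.
- apply/schur/b => // k _ _.
  by rewrite -[n]/(n.+1.-1) -g_size; apply: schur_stable_coef_le.
- have sfg := stability_condition_hadamard_sqrt _ _ _ _ _
    f_monic f_size g_monic g_size lam0 lam1 fglam.
  split; apply: (schur) => //.
  have [_ szfg] : hadamard f g \is monic /\ size (hadamard f g) = size f.
    by apply: size_hadamard_monic => //; rewrite f_size.
  apply: stability_condition_hadamard => //.
    by rewrite szfg f_size [_`_ _]coef_invbin_poly // binn invr1.
  move=> k; rewrite inE szfg f_size => /andP[kn _].
  exact/norm_coef_invbin_poly/ltnW.
Qed.
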